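(* Let $\theta$ be a real number and let $G$ be a $\theta$-super positive graph. Then $N_\theta(G\setminus v)=\varnothing$ for all $v\in V(G)$.
   Context: All graphs are finite and simple. For a graph $G$ on $n$ vertices, $p(G,r)$ is the number of $r$-matchings in $G$ ($p(G,0)=1$), $\mu(G,x)=\sum_{r=0}^{\lfloor n/2\rfloor}(-1)^r p(G,r)x^{n-2r}$ is its matching polynomial, and $\mathrm{mult}(\theta,G)$ is the multiplicity of $\theta$ as a root of $\mu(G,x)$. $G\setminus v$ denotes deletion of vertex $v$. A vertex $u$ of a graph $H$ is $\theta$-neutral if $\mathrm{mult}(\theta,H\setminus u)=\mathrm{mult}(\theta,H)$, and $\theta$-positive if $\mathrm{mult}(\theta,H\setminus u)=\mathrm{mult}(\theta,H)+1$; $N_\theta(H)$ is the set of $\theta$-neutral vertices of $H$. $G$ is $\theta$-super positive if $\mathrm{mult}(\theta,G)=0$ and every vertex of $G$ is $\theta$-positive. *)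

(* Defs.v *)
From mathcomp Require Import all_boot all_order all_algebra.
From mathcomp Require Export reals.
Set Implicit Arguments.
Unset Strict Implicit.
Unset Printing Implicit Defensive.
Import GRing.Theory.
Local Open Scope ring_scope.

(* [T] is only an ambient type of vertex names; the vertex set is [vertices G].
   Thus a graph and its vertex-deleted subgraphs live over the same [T]. *)
Record sgraph (T : finType) := SGraph {
  vertices : {set T};
  edges : {set {set T}};
  edgesP : forall e, e \in edges -> (e \subset vertices) && (#|e| == 2%N)
}.

Section Graph.
Variable T : finType.
Implicit Types (G : sgraph T) (v : T) (M : {set {set T}}) (r : nat).

Lemma delete_vertex_subproof G v (e : {set T}) :
  e \in [set e in edges G | v \notin e] ->
  (e \subset vertices G :\ v) && (#|e| == 2%N).
Proof. by rewrite inE subsetD1 => /andP[/edgesP/andP[-> ->] ->]. Qed.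

Definition delete_vertex G v : sgraph T :=
  SGraph (@delete_vertex_subproof G v).

Definition is_matching G M : bool := (M \subset edges G) && trivIset M.

Definition num_matchings G r : nat :=
  #|[set M : {set {set T}} | is_matching G M & #|M| == r]|.

Variable R : realType.
Implicit Type theta : R.

Definition matching_poly G : {poly R} :=
  \sum_(r < #|vertices G|./2.+1)
    ((-1) ^+ r * (num_matchings G r)%:R) *: 'X^(#|vertices G| - r.*2).

Definition mult theta G : nat := mup theta (matching_poly G).

Definition neutral theta G v : bool :=
  mult theta (delete_vertex G v) == mult theta G.

Definition positive theta G v : bool :=
  mult theta (delete_vertex G v) == (mult theta G).+1.

Definition neutral_vertices theta G : {set T} :=
  [set u in vertices G | neutral theta G u].

Definition super_positive theta G : Prop :=
  mult theta G = 0%N /\ forall v, v \in vertices G -> positive theta G v.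

End Graph.

(* Main.v *)
(** Write [mu] for the matching polynomial and
    [W(G; u, v) = mu(G\u) mu(G\v) - mu(G) mu(G\u\v)].  The vertex recurrence
    [mu(G) = x mu(G\u) - sum_(w ~ u) mu(G\u\w)], applied to [u] in [G] and in
    [G\v], gives
    [W(G; u, v) = [u ~ v] mu(G\u\v)^2 + sum_(w ~ u, w <> v) W(G\u; w, v)],
    so that [W(G; u, v)] is a sum of squares (Heilmann-Lieb, Godsil), and a real
    root of a sum of squares is never simple.  If [G] is [theta]-super positive
    and [u] were neutral in [G\v], then [theta] would be a root of order 2 of
    [mu(G\u) mu(G\v)] and of order 1 of [mu(G) mu(G\u\v)], hence a simple root of
    [W(G; u, v)]. *)
Require Import Defs.
From mathcomp Require Import all_boot all_order all_algebra.
From mathcomp Require Import ring.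

Set Implicit Arguments.
Unset Strict Implicit.
Unset Printing Implicit Defensive.
Import Order.TTheory GRing.Theory Num.Theory.
Local Open Scope ring_scope.

Section SumOfSquares.
Variable F : realFieldType.
Implicit Types (p q : {poly F}) (x : F).

Definition sum_of_squares p : Prop :=
  exists s : seq {poly F}, p = \sum_(q <- s) q ^+ 2.

Lemma sum_of_squares0 : sum_of_squares 0.
Proof. by exists [::]; rewrite big_nil. Qed.

Lemma sum_of_squares_sqr q : sum_of_squares (q ^+ 2).
Proof. by exists [:: q]; rewrite big_seq1. Qed.

Lemma sum_of_squaresD p q :
  sum_of_squares p -> sum_of_squares q -> sum_of_squares (p + q).
Proof. by move=> [s ->] [t ->]; exists (s ++ t); rewrite big_cat. Qed.

Lemma sum_of_squares_sum (I : finType) (P : pred I) (p : I -> {poly F}) :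
  (forall i, P i -> sum_of_squares (p i)) ->
  sum_of_squares (\sum_(i | P i) p i).
Proof.
move=> sosp; apply: (big_ind sum_of_squares) => //; first exact: sum_of_squares0.
exact: sum_of_squaresD.
Qed.

(** Squares are nonnegative at [x], so if they add up to 0 there, each summand vanishes; then
    ['X - x%:P] divides every [q], and its square every [q ^+ 2]. *)
Lemma sum_of_squares_root p x :
  sum_of_squares p -> root p x -> ('X - x%:P) ^+ 2 %| p.
Proof.
move=> [s ->]; rewrite rootE horner_sum psumr_eq0 => [/allP s0|q _]; last first.
  by rewrite horner_exp sqr_ge0.
rewrite big_seq; apply: (big_ind (dvdp (('X - x%:P) ^+ 2))) => [|p1 p2|q /s0]; first exact: dvdp0.
  exact: dvdp_add.
by rewrite horner_exp sqrf_eq0 => qx0; apply: dvdp_exp2r; rewrite dvdp_XsubCl rootE.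
Qed.

End SumOfSquares.

Section MatchingPolynomial.
Variables (R : realType) (T : finType).
Implicit Types (G : sgraph T) (u v w : T) (e : {set T}) (M : {set {set T}}).

Local Notation mu G := (matching_poly R G).
Local Notation "G \v u" := (delete_vertex G u) (at level 50, left associativity).

Lemma edge_subset G e : e \in edges G -> e \subset vertices G.
Proof. by case/edgesP/andP. Qed.

Lemma edge_neq G u w : [set u; w] \in edges G -> u != w.
Proof. by move/edgesP/andP=> [_]; rewrite cards2; case: (u == w). Qed.

Lemma cover_matching_subset G M : is_matching G M -> cover M \subset vertices G.
Proof.
case/andP=> /subsetP ME _; apply/bigcupsP=> e /ME; exact: edge_subset.
Qed.

Lemma card_cover_matching G M : is_matching G M -> #|cover M| = #|M|.*2.
Proof.
case/andP=> /subsetP ME /eqP <-; rewrite -muln2 -sum_nat_const.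
by apply: eq_bigr => e /ME /edgesP /andP[_ /eqP].
Qed.

(** Indexing by the matchings themselves lets the recurrence be proved by bijections; [r] edges
    leave [n - 2r] vertices uncovered. *)
Lemma matching_polyE G :
  mu G = \sum_(M | is_matching G M)
           (-1) ^+ #|M| *: 'X^(#|vertices G :\: cover M|).
Proof.
have leM M : is_matching G M -> (#|M| < #|vertices G|./2.+1)%N.
  move=> mM; rewrite ltnS geq_half_double -(card_cover_matching mM).
  exact/subset_leq_card/cover_matching_subset.
(* By [leM], [inord] never falls back to its default value here. *)
rewrite (partition_big (fun M => inord #|M| : 'I_#|vertices G|./2.+1) xpredT) //.
apply: eq_bigr => r _; rewrite /num_matchings -scalerA scaler_nat.
rewrite -sumr_const scaler_sumr.
apply: eq_big => [M|M].
  rewrite inE; case: (boolP (is_matching G M)) => //= mM.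
  by rewrite -val_eqE /= inordK ?leM.
rewrite inE => /andP[mM /eqP <-]; rewrite cardsD (setIidPr _).
  by rewrite (card_cover_matching mM).
exact: cover_matching_subset.
Qed.

Lemma eq_matching_poly G H :
  vertices G = vertices H -> edges G = edges H -> mu G = mu H.
Proof.
by move=> eqV eqE; rewrite !matching_polyE /is_matching eqV eqE.
Qed.

(** The leading coefficient is 1: only the empty matching leaves every vertex uncovered. *)
Lemma matching_poly_neq0 G : mu G != 0.
Proof.
have: (mu G)`_#|vertices G| = 1.
  rewrite matching_polyE coef_sum (bigD1 set0) /=; last first.
    by rewrite /is_matching sub0set /trivIset /cover !big_set0 cards0.
  rewrite cards0 /cover big_set0 setD0 coefZ coefXn eqxx mulr1 big1 ?addr0 //.
  move=> M /andP[mM M0]; rewrite coefZ coefXn cardsD (setIidPr _); last first.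
    exact: cover_matching_subset.
  have := subset_leq_card (cover_matching_subset mM).
  rewrite (card_cover_matching mM); move: M0; rewrite -card_gt0.
  case: (#|M|) => // m _; case: #|vertices G| => // n le_n.
  by rewrite gtn_eqF ?mulr0 // doubleS subSS ltnS leq_subr.
by apply: contra_eq_neq => ->; rewrite coef0 eq_sym oner_eq0.
Qed.

Lemma is_matching_delete G u M :
  is_matching (G \v u) M = is_matching G M && (u \notin cover M).
Proof.
rewrite /is_matching andbAC; congr (_ && _); apply/subsetP/andP => [ME|[/subsetP ME uM] e eM].
  split; first by apply/subsetP=> e /ME; rewrite inE => /andP[].
  by apply/bigcupP=> -[e /ME]; rewrite inE => /andP[_ /negP].
by rewrite inE ME //=; apply: contra uM => ue; apply/bigcupP; exists e.
Qed.

(** Adding the edge [uw] is injective only on families without it, hence the second conjunct. *)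
Lemma matching_setU1 G u w M : [set u; w] \in edges G ->
  is_matching (G \v u \v w) M =
  is_matching G ([set u; w] |: M) && ([set u; w] \notin M).
Proof.
move=> uwE; rewrite !is_matching_delete; apply/idP/idP.
  case/andP=> /andP[/andP[/subsetP ME trivM] uM] wM.
  have [||trivM' ->] := trivIsetU1 _ trivM (A := [set u; w]).
  - move=> B BM; rewrite disjoint_sym disjoints_subset; apply/subsetP=> x xB.
    have xM: x \in cover M by apply/bigcupP; exists B.
    rewrite !inE negb_or; apply/andP; split.
      by apply: contraNneq uM => <-.
    by apply: contraNneq wM => <-.
  - by apply/negP=> /ME /edgesP /andP[_]; rewrite cards0.
  rewrite andbT /is_matching trivM' andbT.
  by apply/subsetP=> e; rewrite in_setU1 => /predU1P[->|/ME].
case/andP=> /andP[/subsetP ME trivM] uwM.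
have notM x : x \in [set u; w] -> x \notin cover M.
  move=> xuw; apply: contraNN uwM => /bigcupP[B BM xB].
  (* Both [[set u; w]] and [B] are the block of [x], so they coincide and the edge would lie in
     [M]. *)
  rewrite -(def_pblock trivM (setU11 _ _) xuw).
  by rewrite (def_pblock trivM (setU1r _ BM) xB).
rewrite !notM ?set21 ?set22 // !andbT /is_matching (trivIsetS _ trivM) ?subsetU1 ?subsetUr //.
by rewrite andbT; apply/subsetP=> e eM; rewrite ME ?setU1r.
Qed.

(** Matchings missing [u] keep [u] uncovered, which gives the factor ['X]; the others are sorted by
    the partner [w] of [u], and removing the edge [uw] flips the sign. *)
Lemma matching_poly_rec G u : u \in vertices G ->
  mu G = 'X * mu (G \v u)
         - \sum_(w | [set u; w] \in edges G) mu (G \v u \v w).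
Proof.
move=> uV; rewrite [mu G]matching_polyE (bigID (fun M => u \notin cover M)) /=.
congr (_ + _).
  rewrite matching_polyE mulr_sumr (eq_bigl _ _ (is_matching_delete G u)).
  apply: eq_bigr => M /andP[_ uM].
  rewrite -scalerAr -exprS (cardsD1 u) inE uM uV /= add1n.
  by rewrite !setDDl setUC.
(* The inner sum has exactly one term if [M] covers [u] and none otherwise. *)
transitivity (\sum_(M | is_matching G M) \sum_(w | [set u; w] \in M)
    (-1) ^+ #|M| *: 'X^(#|vertices G :\: cover M|) : {poly R}).
  rewrite big_mkcondr; apply: eq_bigr => M /andP[/subsetP ME trivM].
  rewrite negbK; case: ifP => [/bigcupP[e eM ue]|uM]; last first.
    rewrite big_pred0 // => w; apply: contraFF uM => uwM.
    by apply/bigcupP; exists [set u; w]; rewrite ?set21.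
  have /andP[_ /cards2P[x [y [xy def_e]]]] := edgesP (ME _ eM).
  have [w0 def_e0] : exists w0, e = [set u; w0].
    move: ue; rewrite def_e !inE => /pred2P[->|->]; first by exists y.
    by exists x; rewrite setUC.
  rewrite (big_pred1 w0) // => w; apply/idP/eqP => [uwM|->]; last by rewrite -def_e0.
  have := def_pblock trivM uwM (set21 u w).
  rewrite (def_pblock trivM eM ue) def_e0 => /setP/(_ w).
  rewrite !inE eqxx orbT => /predU1P[eq_wu|/eqP //].
  by have := edge_neq (ME _ uwM); rewrite eq_wu eqxx.
rewrite (exchange_big_dep (fun w => [set u; w] \in edges G)) /=; last first.
  by move=> M w /andP[/subsetP ME _] /ME.
rewrite -sumrN; apply: eq_bigr => w uwE.
rewrite matching_polyE -sumrN.
rewrite (reindex_onto (fun M => [set u; w] |: M) (fun M => M :\ [set u; w])) /=; last first.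
  by move=> M /andP[_ eM]; rewrite setD1K.
apply: eq_big => [M|M].
  rewrite matching_setU1 // setU11 andbT; congr (_ && _).
  by apply/eqP/idP => [<-|]; [rewrite setD11 | exact: setU1K].
move=> /andP[/andP[_ _] /eqP eqM].
have uwM : [set u; w] \notin M by rewrite -eqM setD11.
rewrite cardsU1 uwM add1n exprS mulN1r.
rewrite scaleNr; congr (- (_ *: 'X^(#|pred_of_set _|))).
by rewrite !setDDl setUA /cover bigcup_setU big_set1.
Qed.

Local Notation W G u v := (mu (G \v u) * mu (G \v v) - mu G * mu (G \v u \v v)).

Lemma edge_delete G u v w : u != v ->
  ([set u; w] \in edges (G \v v)) = ([set u; w] \in edges G) && (w != v).
Proof. by move=> uv; rewrite !inE negb_or [v == u]eq_sym uv [v == w]eq_sym. Qed.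

Lemma matching_poly_deleteC G u v : mu (G \v u \v v) = mu (G \v v \v u).
Proof.
apply: eq_matching_poly => /=; first by rewrite !setDDl setUC.
by apply/setP=> e; rewrite !inE andbAC.
Qed.

(** Induction on the number of vertices, for all pairs at once: passing to [G \v u] replaces [u] by
    a neighbour [w]. *)
Lemma matching_poly_sum_of_squares G u v :
  u \in vertices G -> v \in vertices G -> u != v -> sum_of_squares (W G u v).
Proof.
have [n] := ubnP #|vertices G|; elim: n => // n IHn in G u v *.
rewrite ltnS => leGn uV vV uv.
have uVv : u \in vertices (G \v v) by rewrite !inE uv.
have -> : W G u v =
    (if [set u; v] \in edges G then mu (G \v u \v v) ^+ 2 else 0)
    + \sum_(w | ([set u; w] \in edges G) && (w != v)) W (G \v u) w v.
  rewrite (matching_poly_rec uV) (matching_poly_rec uVv).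
  rewrite (eq_bigl _ _ (fun w => edge_delete G w uv)) (matching_poly_deleteC G v u).
  have eq_uwv w : mu (G \v v \v u \v w) = mu (G \v u \v w \v v).
    apply: eq_matching_poly => /=; first by rewrite !setDDl setUC setUA.
    by apply/setP=> e; rewrite !inE -!andbA; do !bool_congr.
  rewrite (eq_bigr _ (fun w _ => eq_uwv w)).
  rewrite sumrB -mulr_suml -mulr_sumr.
  (* The term [w = v] occurs only in the recurrence for [G], not for [G \v v]; it produces the
     square, while the two terms in ['X] cancel. *)
  have -> : \sum_(w | [set u; w] \in edges G) mu (G \v u \v w) =
      (if [set u; v] \in edges G then mu (G \v u \v v) else 0)
      + \sum_(w | ([set u; w] \in edges G) && (w != v)) mu (G \v u \v w).
    case: ifPn => [uvE|/negPf uvE]; first by rewrite (bigD1 v).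
    rewrite add0r; apply: eq_bigl => w.
    by case: eqP => [->|]; rewrite ?uvE ?andbT.
  by case: ifP => _; ring.
apply: sum_of_squaresD.
  by case: ifP => _; [exact: sum_of_squares_sqr | exact: sum_of_squares0].
apply: sum_of_squares_sum => w /andP[uwE wv]; apply: IHn => //.
- by rewrite (leq_trans _ leGn) // [leqRHS](cardsD1 u) uV.
- rewrite !inE eq_sym (edge_neq uwE).
  by apply: (subsetP (edge_subset uwE)); rewrite set22.
- by rewrite !inE eq_sym uv.
Qed.

End MatchingPolynomial.

Theorem theorem2p9 (R : realType) (theta : R) (T : finType) (G : sgraph T) :
  super_positive theta G ->
  forall v : T, v \in vertices G ->
    neutral_vertices theta (delete_vertex G v) = set0.
Proof.
case=> multG0 posG v vV; apply/setP=> u; rewrite !inE.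
apply/negP=> /andP[/andP[uv uV]]; rewrite /neutral (eqP (posG v vV)) multG0.
move=> /eqP multGvu.
have multGu := eqP (posG u uV); have multGv := eqP (posG v vV).
rewrite multG0 in multGu multGv.
set Gu := delete_vertex G u in multGu; set Gv := delete_vertex G v in multGv multGvu.
(* Multiplicities add over products of nonzero polynomials. *)
have nz H : matching_poly R H != 0 := matching_poly_neq0 R H.
have sos := matching_poly_sum_of_squares R uV vV uv.
rewrite matching_poly_deleteC -/Gu -/Gv in sos.
have dvd2 : ('X - theta%:P) ^+ 2 %| matching_poly R Gu * matching_poly R Gv.
  by rewrite -mup_geq ?mulf_neq0 // mupM // -/(mult _ _) multGu -/(mult _ _) multGv.
have mult1 :
    mup theta (matching_poly R G * matching_poly R (delete_vertex Gv u)) = 1%N.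
  by rewrite mupM // -/(mult _ _) multG0 -/(mult _ _) multGvu.
(* Modulo [dvd2], both sides of this implication concern the second product only: multiplicity at
   least 1 would force at least 2, against [mult1]. *)
have := sum_of_squares_root sos (x := theta).
rewrite -dvdp_XsubCl dvdp_subr ?(dvdp_trans _ dvd2) ?dvdp_exp //.
rewrite dvdp_subr // -[X in X %| _ -> _]expr1 -!mup_geq ?mulf_neq0 // mult1.
by move/(_ isT).
Qed.
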